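(* Fix $p\in(1,\infty)$ and let $(X,\|\cdot\|_X)$ be a Banach space with $\mathfrak{s}_p(X)<\infty$. If, additionally, $X$ is a UMD$^-$ space, then for every $n\in\mathbb{N}$ and all functions $f_1,\ldots,f_n:\mathcal{C}_n\to X$, we have $$\Big\| \sum_{i=1}^n \Delta^{-1}\partial_i f_i \Big\|_{L_p(\mathcal{C}_n;X)} \leq \mathfrak{s}_p(X)\, \beta_p^-(X) \Big(\frac{1}{2^n} \sum_{\delta\in\mathcal{C}_n} \Big\| \sum_{i=1}^n \delta_i \partial_i f_i\Big\|_{L_p(\mathcal{C}_n;X)}^p\Big)^{1/p}.$$
   Context: Notation. $\mathcal{C}_n=\{-1,1\}^n$ is the discrete hypercube, and points $\delta\in\mathcal{C}_n$ are written $\delta=(\delta_1,\ldots,\delta_n)$. For a measure space $(\Omega,\mathcal{F},\mu)$ and $f:\Omega\to X$, $\|f\|_{L_p(\Omega,\mu;X)}^p=\int_\Omega\|f(\omega)\|_X^p\,d\mu(\omega)$. For finite $\Omega$ with the normalized counting measure one writes $\|f\|_{L_p(\Omega;X)}$; thus $\|f\|_{L_p(\mathcal{C}_n;X)}^p=\frac1{2^n}\sum_{\varepsilon\in\mathcal{C}_n}\|f(\varepsilon)\|_X^p$. For $i\in\{1,\ldots,n\}$ the $i$-th partial derivative of $f:\mathcal{C}_n\to X$ is $$\partial_i f(\varepsilon)=\frac{f(\varepsilon)-f(\varepsilon_1,\ldots,\varepsilon_{i-1},-\varepsilon_i,\varepsilon_{i+1},\ldots,\varepsilon_n)}{2},\qquad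 \varepsilon\in\mathcal{C}_n.$$ Every $f:\mathcal{C}_n\to X$ has a Walsh expansion $f=\sum_{A\subseteq\{1,\ldots,n\}}\widehat f(A)w_A$ with $w_A(\varepsilon)=\prod_{i\in A}\varepsilon_i$ and $\widehat f(A)\in X$. For $\alpha\in\mathbb{R}$ the fractional hypercube Laplacian is $$\Delta^\alpha f=\sum_{\emptyset\neq A\subseteq\{1,\ldots,n\}}|A|^\alpha\,\widehat f(A)\,w_A;$$ $\Delta^{-1}$ is the case $\alpha=-1$. UMD$^-$: $X$ is a UMD$^-$ space if for every $p\in(1,\infty)$ there is $\beta_p^-\in(0,\infty)$ such that for every $n\in\mathbb{N}$, every probability space $(\Omega,\mathcal{F},\mu)$, every filtration $\{\mathcal{F}_i\}_{i=0}^n$ of sub-$\sigma$-algebras of $\mathcal{F}$ and every martingale $\{M_i:\Omega\to X\}_{i=0}^n$ adapted to $\{\mathcal{F}_i\}_{i=0}^n$ (with $M_i\in L_p(\Omega,\mu;X)$), $$\|M_n-M_0\|_{L_p(\Omega,\mu;X)}\leq \beta_p^-\Big(\frac1{2^n}\sum_{\delta\in\mathcal{C}_n}\Big\|\sum_{i=1}^n\delta_i(M_i-M_{i-1})\Big\|_{L_p(\Omega,\mu;X)}^p\Big)^{1/p}.$$ The least such constant is denoted $\beta_p^-(X)$. The parameter $\mathfrak{s}_p(X)\in(0,\infty]$ is the least $\mathfrak{s}\in(0,\infty]$ such that for every probability space $(\Omega,\mathcal{F},\mu)$, every $n\in\mathbb{N}$, every filtration $\{\mathcal{F}_i\}_{i=1}^n$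 of sub-$\sigma$-algebras of $\mathcal{F}$ with corresponding vector valued conditional expectations $E_i=\mathbb{E}[\,\cdot\,|\mathcal{F}_i]$, every sequence of functions $f_1,\ldots,f_n:\Omega\to X$ (in $L_p(\Omega,\mu;X)$) satisfies $$\Big(\frac1{2^n}\sum_{\delta\in\mathcal{C}_n}\Big\|\sum_{i=1}^n\delta_i E_i f_i\Big\|_{L_p(\Omega,\mu;X)}^p\Big)^{1/p}\leq\mathfrak{s}\Big(\frac1{2^n}\sum_{\delta\in\mathcal{C}_n}\Big\|\sum_{i=1}^n\delta_i f_i\Big\|_{L_p(\Omega,\mu;X)}^p\Big)^{1/p}.$$ *)

(* Defs.v *)
From mathcomp Require Import all_boot all_order all_algebra.
From mathcomp Require Import all_classical all_reals all_analysis.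

Set Implicit Arguments.
Unset Strict Implicit.
Unset Printing Implicit Defensive.

Import Order.TTheory GRing.Theory Num.Theory.
Import numFieldNormedType.Exports.

Local Open Scope classical_set_scope.
Local Open Scope ring_scope.

(* {-1,1}^n is encoded by Boolean vectors: [false] stands for the coordinate 1
   and [true] for -1; the actual coordinate is [cube_coord R e i]. *)
Notation cube n := {ffun 'I_n -> bool}.

Definition cube_coord (R : realType) (n : nat) (e : cube n) (i : 'I_n) : R :=
  (-1) ^+ e i.

Definition flip (n : nat) (i : 'I_n) (e : cube n) : cube n :=
  [ffun j => if j == i then ~~ e j else e j].

Section HypercubeAnalysis.
Context {R : realType} {X : normedModType R} {n : nat}.
Implicit Types (f : cube n -> X) (e : cube n) (A : {set 'I_n}).

Definition partial_derivative (i : 'I_n) f : cube n -> X :=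
  fun e => 2^-1 *: (f e - f (flip i e)).

Definition walsh A e : R := \prod_(i in A) cube_coord R e i.

(* The Fourier-Walsh coefficient; [walsh_expansion] below shows that these are
   the coefficients of the Walsh expansion of [f]. *)
Definition walsh_coef f A : X := 2 ^- n *: \sum_(e : cube n) walsh A e *: f e.

Definition laplacian (alpha : R) f : cube n -> X :=
  fun e => \sum_(A : {set 'I_n} | A != finset.set0)
    (#|A|%:R `^ alpha * walsh A e) *: walsh_coef f A.

Definition cube_Lp_norm (p : R) f : R :=
  (2 ^- n * \sum_(e : cube n) `|f e| `^ p) `^ p^-1.

Lemma walsh_kernel e e' :
  \sum_(A : {set 'I_n}) walsh A e * walsh A e' = (2 ^+ n) *+ (e == e').
Proof.
have -> : \sum_(A : {set 'I_n}) walsh A e * walsh A e' =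
          \prod_(i < n) (cube_coord R e i * cube_coord R e' i + 1).
  rewrite bigA_distr /=; apply: eq_bigr => A _.
  by rewrite /walsh -big_split /= big_mkcond.
have [->|/eqP ne] := eqVneq e e'.
  under eq_bigr do rewrite /cube_coord -expr2 sqrr_sign.
  by rewrite prodr_const card_ord.
have [i ei] : exists i, e i != e' i.
  apply/existsP; rewrite -negb_forall; apply/negP => /forallP h.
  by apply: ne; apply/ffunP => i; apply/eqP.
rewrite (bigD1 i)//= /cube_coord -signr_addb.
by move: ei; case: (e i); case: (e' i) => //= _; rewrite expr1 addNr mul0r.
Qed.

Lemma walsh_expansion f e :
  f e = \sum_(A : {set 'I_n}) walsh A e *: walsh_coef f A.
Proof.
under eq_bigr do rewrite /walsh_coef scalerA mulrC -scalerA scaler_sumr.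
rewrite -scaler_sumr exchange_big /=.
under eq_bigr => e' _.
  under eq_bigr do rewrite scalerA.
  rewrite -scaler_suml walsh_kernel.
  over.
rewrite (bigD1 e)//= eqxx big1 => [|e' /negPf]; last first.
  by rewrite eq_sym => ->; rewrite scale0r.
by rewrite addr0 mulr1n scalerA mulVf ?scale1r// expf_neq0// pnatr_eq0.
Qed.

End HypercubeAnalysis.

Section VectorValued.
Context {R : realType} {X : normedModType R}.
Context {d : measure_display} {T : measurableType d}.
Implicit Types (P : probability T R) (G : set (set T)) (f g s : T -> X)
  (A : set T).

Definition simple_wrt G s : Prop :=
  finite_set (range s) /\ forall x, G (s @^-1` [set x]).

(* Pointwise (rather than a.e.) limits of simple functions: every a.e. class of
   strongly measurable functions has such a representative, and for these the
   norm [`|f|] is a measurable function. *)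
Definition strongly_measurable G f : Prop :=
  exists s : nat -> T -> X,
    (forall k, simple_wrt G (s k)) /\
    (forall w, (fun k => s k w) @ \oo --> f w).

Definition simple_integral P A s : X :=
  \sum_(x \in range s) fine (P (A `&` s @^-1` [set x])) *: x.

(* A relation: [f] is Bochner integrable over [A] and its integral is [x]. *)
Definition is_bochner_integral P A f (x : X) : Prop :=
  strongly_measurable measurable f /\
  exists s : nat -> T -> X,
    [/\ forall k, simple_wrt measurable (s k),
        (fun k => \int[P]_(w in A) (`|f w - s k w|)%:E)%E @ \oo --> 0%E &
        (fun k => simple_integral P A (s k)) @ \oo --> x].

(* [g] is a version of the conditional expectation of [f] given [G]; the clause
   [A = setT] contains the integrability of [f] and [g]. *)
Definition is_cond_exp P G f g : Prop :=
  strongly_measurable G g /\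
  forall A, G A ->
    exists x, is_bochner_integral P A f x /\ is_bochner_integral P A g x.

Definition Lp_norm P (p : R) f : \bar R :=
  'N[P]_(p%:E)[EFin \o (fun w => `|f w|%R)]%E.

Definition in_Lp P (p : R) f : Prop :=
  strongly_measurable measurable f /\ (Lp_norm P p f < +oo)%E.

Definition is_filtration (k : nat) (F : 'I_k -> set (set T)) : Prop :=
  (forall i, sigma_algebra setT (F i) /\ F i `<=` measurable) /\
  (forall i j : 'I_k, (i <= j)%N -> F i `<=` F j).

(* Taking [i = j] gives adaptedness and integrability of [M i]. *)
Definition is_martingale P (k : nat) (F : 'I_k -> set (set T))
    (M : 'I_k -> T -> X) : Prop :=
  forall i j : 'I_k, (i <= j)%N -> is_cond_exp P (F i) (M j) (M i).

(* ( 2^-n \sum_delta || \sum_i delta_i g_i ||_{L_p(P; X)}^p )^(1/p) *)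
Definition sign_average P (p : R) (n : nat) (g : 'I_n -> T -> X) : \bar R :=
  (((2 ^- n)%:E * \sum_(delta : cube n)
      (Lp_norm P p
        (fun w => (\sum_(i < n) cube_coord R delta i *: g i w)%R)) `^ p)
    `^ p^-1)%E.

End VectorValued.

Section Constants.
Context {R : realType} (X : completeNormedModType R).

(* The increment M_(i+1) - M_i, for i = 0, ..., n-1. *)
Definition increment (T : Type) (n : nat) (M : 'I_n.+1 -> T -> X) (i : 'I_n) :
    T -> X :=
  fun w => M (lift ord0 i) w - M (widen_ord (leqnSn n) i) w.

Definition UMD_minus_with (p b : R) : Prop :=
  forall (n : nat) (d : measure_display) (T : measurableType d)
    (P : probability T R) (F : 'I_n.+1 -> set (set T)) (M : 'I_n.+1 -> T -> X),
    is_filtration F -> is_martingale P F M -> (forall i, in_Lp P p (M i)) ->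
    (Lp_norm P p (fun w => (M ord_max w - M ord0 w)%R)
       <= b%:E * sign_average P p (increment M))%E.

Definition UMD_minus : Prop :=
  forall p : R, 1 < p -> exists b : R, 0 < b /\ UMD_minus_with p b.

Definition beta_minus (p : R) : \bar R :=
  ereal_inf [set b%:E | b in [set b : R | 0 < b /\ UMD_minus_with p b]].

Definition stein_with (p : R) (s : \bar R) : Prop :=
  forall (d : measure_display) (T : measurableType d) (P : probability T R)
    (n : nat) (F : 'I_n -> set (set T)) (f Ef : 'I_n -> T -> X),
    is_filtration F -> (forall i, in_Lp P p (f i)) ->
    (forall i, is_cond_exp P (F i) (f i) (Ef i)) ->
    (sign_average P p Ef <= s * sign_average P p f)%E.

Definition stein_const (p : R) : \bar R :=
  ereal_inf [set s : \bar R | (0 < s)%E /\ stein_with p s].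

End Constants.

(* Main.v *)
Require Import Defs.
From HB Require Import structures.
From mathcomp Require Import all_boot all_order all_algebra all_fingroup.
From mathcomp Require Import all_classical all_reals all_analysis.
Import Order.TTheory GRing.Theory Num.Theory.
Import numFieldNormedType.Exports.
Local Open Scope classical_set_scope.
Local Open Scope ring_scope.

(** Reveal the coordinates of a uniform point of the cube one at a time, in the
    order prescribed by a permutation [r], and let [S_i] be the set of
    coordinates revealed up to and including [i].  Since the Walsh expansion of
    the derivative of [f i] in direction [i] only involves sets containing
    [i], its conditional expectation given the coordinates in [S_i] keeps
    exactly the frequencies [A] in which [i] is the last revealed element.
    Such a projection is odd in the coordinate revealed at that moment, so the
    projections, listed in order of revelation, are the increments of a
    martingale ([is_martingale_order], [increment_order]).  The UMD- inequality
    bounds the norm of their sum by the sign average of the projections, and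
    Stein's inequality bounds that by the sign average of the derivatives
    themselves ([fixed_order_bound]).

    Now choose [r] uniformly at random.  By symmetry, a given element of [A]
    comes last in [A] with probability [1 / #|A|] ([card_last_in]), so the
    average over [r] of the sums of projections is the sum of the inverse
    Laplacians of the derivatives ([laplacian_order_average]).  The bound for
    a fixed order passes to the average by Minkowski's inequality
    ([ler_cube_Lp_norm_avg]).

    The two inequalities are applied on the finite probability space formed by
    the cube with all its subsets, on which a conditional expectation is
    recognised by comparing finite sums ([is_cond_exp_cube]). *)

(** * The cube as a finite probability space *)

(** An alias, so that the discrete sigma-algebra is attached to the cube without
    becoming an instance on every type of finite functions. *)
Definition discrete_cube (n : nat) := cube n.

HB.instance Definition _ n := Finite.on (discrete_cube n).
HB.instance Definition _ n :=
  isPointed.Build (discrete_cube n) ([ffun=> false] : cube n).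
HB.instance Definition _ n := @isMeasurable.Build default_measure_display
  (discrete_cube n) discrete_measurable discrete_measurable0
  discrete_measurableC discrete_measurableU.

Section UniformMeasure.
Context {R : realType} {n : nat}.
Local Notation T := (discrete_cube n).

(** The atoms are indexed by natural numbers because [msum] sums an initial
    segment of a sequence of measures. *)
Definition cube_uniform_atom (k : nat) : {measure set T -> \bar R} :=
  mscale (2 ^- n)%:nng (dirac (nth point (enum T) k : T)).

Definition cube_uniform : set T -> \bar R := msum cube_uniform_atom #|T|.

HB.instance Definition _ := Measure.on cube_uniform.

Lemma ge0_integral_cube_uniform (A : set T) (f : T -> \bar R) :
  (forall e, 0 <= f e)%E ->
  (\int[cube_uniform]_(e in A) f e =
   \sum_(e : T) ((2 ^- n)%:E * (\d_e A * f e)))%E.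
Proof.
move=> f0; rewrite ge0_integral_measure_sum//.
under eq_bigr do rewrite ge0_integral_mscale// integral_dirac//.
rewrite -(big_mkord xpredT (fun k => (2 ^- n)%:E *
  (\d_(nth point (enum T) k : T) A * f (nth point (enum T) k)))%E).
by rewrite cardE -(big_nth point xpredT
  (fun e : T => (2 ^- n)%:E * (\d_e A * f e))%E) big_enum.
Qed.

Lemma cube_uniformE (A : set T) :
  cube_uniform A = (2 ^- n * \sum_(e : T) \1_A e)%:E.
Proof.
transitivity (\int[cube_uniform]_e (\1_A e)%:E)%E.
  by rewrite integral_indic// setIT.
rewrite ge0_integral_cube_uniform//.
rewrite mulr_sumr -sumEFin; apply: eq_bigr => e _.
by rewrite diracT mul1e EFinM.
Qed.

Lemma cube_uniform_setT : cube_uniform setT = 1%E.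
Proof.
rewrite cube_uniformE; under eq_bigr do rewrite indicT.
by rewrite sumr_const card_ffun card_bool card_ord natrX mulVf//.
Qed.

HB.instance Definition _ :=
  Measure_isProbability.Build _ _ _ cube_uniform cube_uniform_setT.

End UniformMeasure.

Section FiniteBochner.
Context {R : realType} {X : normedModType R} {n : nat}.
Local Notation T := (discrete_cube n).
Local Notation P := (@cube_uniform R n : probability T R).
Implicit Types (f g : cube n -> X) (G : set (set T)) (p : R).

Lemma Lp_norm_cube_uniform p f : Lp_norm P p f = (cube_Lp_norm p f)%:E.
Proof.
rewrite /Lp_norm unlock ge0_integral_cube_uniform; last first.
  by move=> e; exact: poweR_ge0.
rewrite /cube_Lp_norm -poweR_EFin mulr_sumr -sumEFin; congr (_ `^ _)%E.
by apply: eq_bigr => e _; rewrite diracT mul1e /= normr_id.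
Qed.

Lemma sign_average_cube_uniform p m (g : 'I_m -> cube n -> X) :
  sign_average P p g =
  ((2 ^- m * \sum_(delta : cube m) cube_Lp_norm p (fun e =>
      \sum_(i < m) cube_coord R delta i *: g i e) `^ p) `^ p^-1)%:E.
Proof.
rewrite /sign_average; under eq_bigr do rewrite Lp_norm_cube_uniform poweR_EFin.
by rewrite sumEFin -EFinM poweR_EFin.
Qed.

Lemma simple_wrt_cube G f : (forall x, G (f @^-1` [set x])) -> simple_wrt G f.
Proof.
by split=> //; apply: finite_image; exact: (@finite_finset (cube n)).
Qed.

Lemma simple_integral_cube_uniform (A : set T) f :
  simple_integral P A f = 2 ^- n *: \sum_(e : cube n) \1_A e *: f e.
Proof.
have fr : finite_set (range f).
  by apply: finite_image; exact: (@finite_finset (cube n)).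
rewrite /simple_integral fsbig_finite//=.
under eq_bigr do rewrite cube_uniformE/= -scalerA.
rewrite -scaler_sumr; congr (_ *: _).
rewrite (eq_bigr (fun x => \sum_(e : T) \1_(A `&` f @^-1` [set x]) e *: x));
  last by move=> x _; exact: scaler_suml.
rewrite exchange_big/=; apply: eq_bigr => e _.
have fe : f e \in finmap.enum_fset (fset_set (range f)).
  by have /= -> := in_fset_set fr (f e); rewrite inE; exists e.
rewrite (bigD1_seq (f e) fe (finmap.fset_uniq _))/= big1 ?addr0 => [|x xf].
  by rewrite !indicE in_setI (mem_set (A := f @^-1` [set f e]))// andbT.
rewrite indicE memNset ?scale0r// => -[_ /= fx].
by rewrite fx eqxx in xf.
Qed.

(** Every function on a finite space is simple, hence approximated by the
    constant sequence equal to itself. *)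
Lemma is_bochner_integral_cube (A : set T) f :
  is_bochner_integral P A f (2 ^- n *: \sum_(e : cube n) \1_A e *: f e).
Proof.
have sf : simple_wrt (@measurable _ T) f by exact: simple_wrt_cube.
split.
  by exists (fun=> f); split=> // w; exact: cvg_cst.
exists (fun=> f); split=> //.
  under eq_fun do under eq_integral do rewrite subrr normr0.
  by under eq_fun do rewrite integral0; exact: cvg_cst.
by rewrite simple_integral_cube_uniform; exact: cvg_cst.
Qed.

Lemma in_Lp_cube p f : in_Lp P p f.
Proof.
split; last by rewrite Lp_norm_cube_uniform ltry.
by exists (fun=> f); split=> [k|w]; [exact: simple_wrt_cube|exact: cvg_cst].
Qed.

(** All integrability conditions being automatic on a finite space, only the
    measurability of [g] and the equality of integrals over the sets of [G]
    remain. *)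
Lemma is_cond_exp_cube G f g :
  (forall x, G (g @^-1` [set x])) ->
  (forall A, G A ->
     \sum_(e : cube n) \1_A e *: f e = \sum_(e : cube n) \1_A e *: g e) ->
  is_cond_exp P G f g.
Proof.
move=> Gg fg; split.
  by exists (fun=> g); split=> [k|w]; [exact: simple_wrt_cube|exact: cvg_cst].
move=> A GA; exists (2 ^- n *: \sum_(e : cube n) \1_A e *: f e); split.
  exact: is_bochner_integral_cube.
by rewrite fg//; exact: is_bochner_integral_cube.
Qed.

End FiniteBochner.

(** * Walsh projections as conditional expectations *)

Section WalshProjection.
Context {R : realType} {X : normedModType R} {n : nat}.
Local Notation P := (@cube_uniform R n : probability (discrete_cube n) R).
Implicit Types (f : cube n -> X) (A S : {set 'I_n}) (i : 'I_n).

Lemma flipK i : involutive (@flip n i).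
Proof.
by move=> e; apply/ffunP => j; rewrite !ffunE; case: eqP => //; rewrite negbK.
Qed.

Lemma walsh_flip A i e :
  walsh A (flip i e) = (-1) ^+ (i \in A) * walsh A e :> R.
Proof.
have coordE j : cube_coord R (flip i e) j =
    (-1) ^+ (j == i) * cube_coord R e j.
  by rewrite /cube_coord ffunE -signr_addb; case: eqP.
rewrite /walsh (eq_bigr _ (fun j _ => coordE j)) big_split/=; congr (_ * _).
have [iA|iA] := boolP (i \in A).
  rewrite (bigD1 i)//= eqxx big1 ?mulr1// => j /andP[_ /negPf->].
  by rewrite expr0.
by rewrite big1// => j jA; case: eqP => [ji|//]; rewrite -ji jA in iA.
Qed.

(** Flipping coordinate [i] multiplies the Walsh function of [A] by [-1] or [1],
    according to whether [i] belongs to [A]. *)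
Lemma walsh_coef_partial_derivative i f A :
  walsh_coef (partial_derivative i f) A =
  if i \in A then walsh_coef f A else 0.
Proof.
have eA : \sum_e walsh A e *: f (flip i e) =
    ((-1) ^+ (i \in A) : R) *: \sum_e walsh A e *: f e.
  rewrite (reindex_inj (inv_inj (flipK i)))/= scaler_sumr.
  by apply: eq_bigr => e _; rewrite flipK walsh_flip scalerA.
rewrite /walsh_coef /partial_derivative.
under eq_bigr do rewrite scalerA mulrC -scalerA scalerBr.
rewrite -scaler_sumr sumrB eA; case: (i \in A).
  rewrite expr1 scaleN1r opprK (scalerDr 2^-1) -scalerDl.
  by rewrite -[2^-1]div1r -splitr scale1r.
by rewrite expr0 scale1r subrr !scaler0.
Qed.

(** The sigma-algebra generated by the coordinates in [S]: on the cube, a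
    set depends only on these coordinates when it is stable under flipping any
    of the others. *)
Definition coord_sigma_algebra S : set (set (discrete_cube n)) :=
  [set B | forall i e, i \notin S -> B e -> B (flip i e)].

Lemma sigma_algebra_coord S : sigma_algebra setT (coord_sigma_algebra S).
Proof.
split=> [//|B SB|F SF] i e iS.
  by move=> -[_ nBe]; split=> // /(SB i _ iS); rewrite flipK.
by move=> [k _ Fke]; exists k => //; exact: SF.
Qed.

Lemma coord_sigma_algebraS S S' : S \subset S' ->
  coord_sigma_algebra S `<=` coord_sigma_algebra S'.
Proof.
move=> SS' B SB i e iS'; apply: SB; apply: contraNN iS'.
exact/fintype.subsetP.
Qed.

(** Flip a coordinate of [A] outside [S]: this preserves [B] and changes the
    sign of the Walsh function, so the sum is its own opposite. *)
Lemma sum_indic_walsh0 (B : set (cube n)) A S :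
  coord_sigma_algebra S B -> ~~ (A \subset S) ->
  \sum_e \1_B e * walsh A e = 0 :> R.
Proof.
move=> SB /fintype.subsetPn[i iA iS]; set s := LHS.
suff: s = - s by move/eqP; rewrite -addr_eq0 -mulr2n mulrn_eq0 => /eqP.
rewrite {1}/s (reindex_inj (inv_inj (flipK i)))/= -sumrN.
apply: eq_bigr => e _; rewrite walsh_flip iA expr1 mulN1r mulrN.
rewrite !indicE; congr (- (_%:R * _)).
congr nat_of_bool; apply/idP/idP; rewrite !inE => Be; last exact: SB.
by rewrite -(flipK i e); exact: SB.
Qed.

(** The projection onto the frequencies contained in [S], which is the
    conditional expectation given the coordinates in [S]. *)
Definition walsh_proj S f : cube n -> X :=
  fun e => \sum_(A : {set 'I_n} | A \subset S) walsh A e *: walsh_coef f A.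

Lemma walsh_proj_flip S f i e : i \notin S ->
  walsh_proj S f (flip i e) = walsh_proj S f e.
Proof.
move=> iS; apply: eq_bigr => A /fintype.subsetP AS; rewrite walsh_flip.
by rewrite (negPf (contraNN (AS i) iS)) mul1r.
Qed.

(** Over a set depending only on the coordinates in [S'], the frequencies not
    contained in [S'] integrate to zero. *)
Lemma sum_indic_walsh_proj (B : set (cube n)) S S' f :
  coord_sigma_algebra S' B ->
  \sum_e \1_B e *: walsh_proj S f e =
  \sum_(A : {set 'I_n} | A \subset S :&: S')
    (\sum_e \1_B e * walsh A e : R) *: walsh_coef f A.
Proof.
move=> S'B; transitivity (\sum_(A : {set 'I_n} | A \subset S)
    (\sum_e \1_B e * walsh A e : R) *: walsh_coef f A).
  under eq_bigr do rewrite /walsh_proj scaler_sumr.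
  rewrite exchange_big/=; apply: eq_bigr => A _; rewrite scaler_suml.
  by apply: eq_bigr => e _; rewrite scalerA.
rewrite (bigID (fun A => A \subset S'))/= [X in _ + X]big1 ?addr0.
  by apply: eq_bigl => A; rewrite finset.subsetI.
by move=> A /andP[_ AS']; rewrite (sum_indic_walsh0 _ _ _ S'B AS') scale0r.
Qed.

Lemma walsh_projT f : walsh_proj finset.setT f = f.
Proof.
apply/funext => e; rewrite (walsh_expansion f e).
by apply: eq_bigl => A; rewrite finset.subsetT.
Qed.

Lemma is_cond_exp_walsh_proj S f :
  is_cond_exp P (coord_sigma_algebra S) f (walsh_proj S f).
Proof.
apply: is_cond_exp_cube => [x i e iS|B SB].
  by rewrite /= walsh_proj_flip.
rewrite -{1}(walsh_projT f) !(sum_indic_walsh_proj _ _ _ _ SB).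
by rewrite finset.setTI finset.setIid.
Qed.

(** The martingale difference property: projecting the derivative in direction
    [i] leaves only frequencies that contain [i], and these integrate to zero
    over every set that does not depend on coordinate [i]. *)
Lemma sum_indic_derivative0 (B : set (cube n)) S S' i f :
  coord_sigma_algebra S' B -> i \notin S' ->
  \sum_e \1_B e *: walsh_proj S (partial_derivative i f) e = 0.
Proof.
move=> S'B iS'; rewrite (sum_indic_walsh_proj _ _ _ _ S'B) big1// => A.
rewrite finset.subsetI => /andP[_ /fintype.subsetP AS'].
by rewrite walsh_coef_partial_derivative (negPf (contraNN (AS' i) iS')) scaler0.
Qed.

End WalshProjection.

(** * Random orders and the inverse Laplacian *)

Section RandomOrder.
Context {n : nat}.
Implicit Types (r : {perm 'I_n}) (A : {set 'I_n}).

(** [r i] is the time at which coordinate [i] is revealed. *)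
Definition initial_segment r (k : nat) : {set 'I_n} := [set i | (r i < k)%N].

Lemma initial_segmentS r (k l : nat) : (k <= l)%N ->
  initial_segment r k \subset initial_segment r l.
Proof.
by move=> kl; apply/fintype.subsetP => i; rewrite !inE => /leq_trans ->.
Qed.

(** Composing with a transposition shows that the number of orders in which a
    given element of [A] comes last does not depend on this element; as every
    order has exactly one last element of [A], these numbers add up to [n`!]. *)
Lemma card_last_in A i : i \in A ->
  (#|[set r : {perm 'I_n} | A \subset initial_segment r (r i).+1]%SET| * #|A|
   = n`!)%N.
Proof.
set last_in := fun r j => A \subset initial_segment r (r j).+1.
have lastP r j : reflect (forall k, k \in A -> (r k <= r j)%N) (last_in r j).
  apply: (iffP fintype.subsetP) => rA k /rA; by rewrite inE ltnS.
move=> iA.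
have swap j : j \in A ->
    #|[set r | last_in r j]%SET| = #|[set r | last_in r i]%SET|.
  move=> jA; rewrite -(card_imset _ (mulgI (tperm i j))); apply: eq_card => r.
  have tA k : (tperm i j k \in A) = (k \in A).
    by case: tpermP => // ->; rewrite iA jA.
  apply/imsetP/idP => [[q]|]; rewrite !inE => /lastP rA.
    move=> ->; apply/lastP => k kA; rewrite !permM tpermL.
    by apply: rA; rewrite tA.
  exists (tperm i j * r)%g; last by rewrite mulgA tperm2 mul1g.
  rewrite inE; apply/lastP => k kA; rewrite !permM tpermR.
  by apply: rA; rewrite tA.
transitivity (\sum_(j in A) #|[set r | last_in r j]%SET|)%N.
  by rewrite (eq_bigr _ swap) sum_nat_const mulnC.
rewrite -card_Sn.
under eq_bigr do rewrite -sum1dep_card big_mkcond/=.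
rewrite exchange_big -sum1_card/=; apply: eq_bigr => r _.
rewrite -big_mkcondr sum1dep_card.
have [k kA kmax] : exists2 k, k \in A & forall j, j \in A -> (r j <= r k)%N.
  by case: (@arg_maxnP _ i (mem A) (fun j => r j) iA) => k; exists k.
rewrite (_ : [set _ | _]%SET = [set k]%SET) ?cards1//.
apply/setP => j; rewrite !inE; apply/andP/eqP => [[jA /lastP jmax]|->].
  by apply/(@perm_inj _ r)/ord_inj/eqP; rewrite eqn_leq jmax ?kmax.
by split=> //; apply/lastP.
Qed.

End RandomOrder.

(** In the average over all orders, the frequency [A] of the derivative in
    direction [i] receives the probability that [i] is the last element of [A],
    which is [#|A|^-1]. *)
Lemma laplacian_order_average {R : realType} {X : normedModType R} {n : nat}
    (f : 'I_n -> cube n -> X) (e : cube n) :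
  \sum_(i < n) laplacian (-1) (partial_derivative i (f i)) e =
  (n`!%:R^-1 : R) *: \sum_(r : {perm 'I_n}) \sum_(i < n)
    walsh_proj (initial_segment r (r i).+1) (partial_derivative i (f i)) e.
Proof.
rewrite [in RHS]exchange_big scaler_sumr/=; apply: eq_bigr => i _.
rewrite /walsh_proj; under eq_bigr do rewrite big_mkcond.
rewrite exchange_big/= scaler_sumr /laplacian big_mkcond/=.
apply: eq_bigr => A _; rewrite walsh_coef_partial_derivative.
have [iA|iA] /= := boolP (i \in A); last first.
  by rewrite !scaler0 if_same big1 ?scaler0// => r _; rewrite if_same.
have A0 : A != finset.set0 by apply/set0Pn; exists i.
rewrite A0 -big_mkcond sumr_const -scalerMnr scalerMnl -scalerA.
congr (_ *: _).
have A_neq0 : #|A|%:R != 0 :> R by rewrite pnatr_eq0 cards_eq0.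
apply: (mulIf A_neq0); rewrite powR_inv1// mulVf//.
rewrite mulr_natr -mulrnA -cardsE card_last_in//.
by rewrite -[RHS]mulr_natr mulVf// pnatr_eq0 -lt0n fact_gt0.
Qed.

Section LpNorm.
Context {R : realType} {X : normedModType R} {n : nat} {p : R}.
Hypothesis p1 : 1 < p.
Implicit Types (f g : cube n -> X).
Local Notation P := (@cube_uniform R n : probability (discrete_cube n) R).

Lemma ler_cube_Lp_norm (Y : normedModType R) f (g : cube n -> Y) :
  (forall e, `|f e| <= `|g e|) -> cube_Lp_norm p f <= cube_Lp_norm p g.
Proof.
move=> fg; have p0 : 0 <= p by rewrite ltW// (lt_trans ltr01).
have sum_ge0 (Z : normedModType R) (h : cube n -> Z) :
    0 <= 2 ^- n * \sum_e `|h e| `^ p.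
  by rewrite mulr_ge0// sumr_ge0// => e _; exact: powR_ge0.
rewrite ge0_ler_powR ?invr_ge0 ?nnegrE// ler_pM2l ?invr_gt0 ?exprn_gt0//.
by apply: ler_sum => e _; rewrite ge0_ler_powR ?nnegrE.
Qed.

Lemma ler_cube_Lp_normD f g :
  cube_Lp_norm p (fun e => f e + g e) <= cube_Lp_norm p f + cube_Lp_norm p g.
Proof.
pose nf e : R^o := `|f e|; pose ng e : R^o := `|g e|.
have nrm (h : cube n -> X) :
    'N[P]_p%:E[EFin \o (fun e => `|h e|%R)]%E = (cube_Lp_norm p h)%:E.
  exact: Lp_norm_cube_uniform.
(* Minkowski's inequality holds for the real functions [nf] and [ng], which have
   the same norms as [f] and [g]. *)
have := @minkowski_EFin _ _ _ P (fun e => `|f e|) (fun e => `|g e|) p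
  _ _ (ltW p1).
rewrite !nrm -EFinD.
have -> : 'N[P]_p%:E[EFin \o ((fun e => `|f e|) \+ (fun e => `|g e|))%R]%E =
   (cube_Lp_norm p (fun e => nf e + ng e))%:E.
  rewrite -Lp_norm_cube_uniform /Lp_norm; congr (Lnorm _ _ _).
  apply/funext => e /=; congr EFin; symmetry.
  by apply/ger0_norm/addr_ge0; exact: normr_ge0.
rewrite lee_fin => h; apply: le_trans (h _ _) => //.
apply: ler_cube_Lp_norm => e.
apply: le_trans (ler_normD _ _) _; exact: ler_norm.
Qed.

Lemma cube_Lp_normZ (a : R) f : 0 <= a ->
  cube_Lp_norm p (fun e => a *: f e) = a * cube_Lp_norm p f.
Proof.
move=> a0; have p0 : 0 < p := lt_trans ltr01 p1.
rewrite /cube_Lp_norm.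
under eq_bigr do rewrite normrZ (ger0_norm a0) powRM//.
rewrite -mulr_sumr mulrCA powRM ?powR_ge0//; last first.
  by rewrite mulr_ge0// sumr_ge0// => e _; exact: powR_ge0.
by rewrite -powRrM mulfV ?gt_eqF// powRr1.
Qed.

(** The triangle inequality, in the form needed to pass from a bound for each
    order to a bound for their average. *)
Lemma ler_cube_Lp_norm_avg (I : finType) (h : I -> cube n -> X) (K : R) :
  (0 < #|I|)%N -> (forall i, cube_Lp_norm p (h i) <= K) ->
  cube_Lp_norm p (fun e => #|I|%:R^-1 *: \sum_(i : I) h i e) <= K.
Proof.
move=> I0 hK; rewrite cube_Lp_normZ// ler_pdivrMl ?ltr0n//.
apply: (@le_trans _ _ (\sum_(i : I) cube_Lp_norm p (h i))); last first.
  by rewrite mulr_natl -sumr_const ler_sum.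
elim: (index_enum I) => [|i s IHs].
  (* The zero function is written as a multiple of itself to use homogeneity. *)
  under [in leLHS]eq_fun do rewrite big_nil -(scale0r 0).
  by rewrite cube_Lp_normZ// mul0r big_nil.
under [in leLHS]eq_fun do rewrite big_cons.
by rewrite big_cons (le_trans (ler_cube_Lp_normD _ _))// lerD2l.
Qed.

End LpNorm.

(** * The martingale attached to a fixed order *)

Section FixedOrder.
Context {R : realType} {X : normedModType R} {n : nat} (p : R).
Variables (f : 'I_n -> cube n -> X) (r : {perm 'I_n}).
Local Notation P := (@cube_uniform R n : probability (discrete_cube n) R).
Local Notation F k := (coord_sigma_algebra (initial_segment r k)).

Definition ordered_derivative (k : 'I_n) : cube n -> X :=
  partial_derivative ((r^-1)%g k) (f ((r^-1)%g k)).

(** Both the [k]-th increment of the martingale and the conditional expectation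
    to which Stein's inequality applies: the [k]-th derivative is projected at
    the time when its own coordinate is revealed. *)
Definition order_difference (k : 'I_n) : cube n -> X :=
  walsh_proj (initial_segment r k.+1) (ordered_derivative k).

Definition order_martingale (k : 'I_n.+1) : cube n -> X :=
  fun e => \sum_(j < n | (j < k)%N) order_difference j e.

(** The martingale uses [h k = k], while Stein's inequality is applied with
    [h k = k.+1], where the coordinate of the [k]-th derivative is known. *)
Lemma is_filtration_order m (h : 'I_m -> nat) :
  (forall i j : 'I_m, (i <= j)%N -> (h i <= h j)%N) ->
  is_filtration (fun k => F (h k)).
Proof.
move=> mono_h; split=> [i|i j ij].
  by split=> //; exact: sigma_algebra_coord.
by apply: coord_sigma_algebraS; apply: initial_segmentS; exact: mono_h.
Qed.

(** The differences of index at least [i] are derivatives along coordinates not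
    yet revealed at time [i], hence have mean zero on the sets of the [i]-th
    sigma-algebra; the other differences are measurable for it. *)
Lemma is_martingale_order : is_martingale P (fun k => F k) order_martingale.
Proof.
move=> i j ij; apply: is_cond_exp_cube => [x c e cS|B FB].
  suff -> : (order_martingale i @^-1` [set x]) (flip c e) =
            (order_martingale i @^-1` [set x]) e by [].
  rewrite /= /order_martingale.
  rewrite (eq_bigr (fun l => order_difference l e))// => l li.
  apply: walsh_proj_flip; apply: contraNN cS.
  by apply/fintype.subsetP/initial_segmentS.
rewrite /order_martingale.
under eq_bigr do rewrite scaler_sumr.
under [RHS]eq_bigr do rewrite scaler_sumr.
rewrite exchange_big [RHS]exchange_big/=.
rewrite (bigID (fun l : 'I_n => (l < i)%N))/= [X in _ + X]big1 ?addr0.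
  apply: eq_bigl => l; apply/andP/idP => [[]//|li]; split=> //.
  exact: leq_trans li ij.
move=> l /andP[_ li]; apply: sum_indic_derivative0 FB _.
by rewrite inE permKV.
Qed.

Lemma order_martingale_total (e : cube n) :
  order_martingale ord_max e - order_martingale ord0 e =
  \sum_(i < n)
    walsh_proj (initial_segment r (r i).+1) (partial_derivative i (f i)) e.
Proof.
rewrite /order_martingale [X in _ - X]big_pred0// subr0.
rewrite (eq_bigl xpredT) => [|j]; last exact: ltn_ord.
rewrite (reindex_perm r)/=; apply: eq_bigr => i _.
by rewrite /order_difference /ordered_derivative permK.
Qed.

(** The signs are exchangeable, so listing the derivatives in the order [r] does
    not change their sign average. *)
Lemma sign_average_order :
  sign_average P p ordered_derivative =
  ((2 ^- n * \sum_(delta : cube n)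
     cube_Lp_norm p (fun e : cube n =>
       (\sum_(i < n)
         cube_coord R delta i *: partial_derivative i (f i) e)) `^ p)
   `^ p^-1)%:E.
Proof.
pose h (delta : cube n) : cube n := [ffun i => delta (r i)].
have h_inj : injective h.
  apply: (can_inj (g := fun delta : cube n => [ffun k => delta ((r^-1)%g k)])).
  by move=> delta; apply/ffunP => k; rewrite !ffunE permKV.
have sum_h delta : (fun e => \sum_(k < n)
      cube_coord R delta k *: ordered_derivative k e) =
    (fun e => \sum_(i < n)
      cube_coord R (h delta) i *: partial_derivative i (f i) e).
  apply/funext => e; rewrite [RHS](reindex_perm (r^-1)%g)/=.
  by apply: eq_bigr => k _; rewrite /cube_coord ffunE permKV.
rewrite sign_average_cube_uniform.
apply: (f_equal (fun x => ((2 ^- n * x) `^ p^-1)%:E)).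
apply: etrans; last exact/esym/(reindex_inj h_inj).
apply: eq_bigr => delta _.
exact: (f_equal (fun g => cube_Lp_norm p g `^ p) (sum_h delta)).
Qed.

End FixedOrder.

Section FixedOrderBound.
Context {R : realType} {X : completeNormedModType R} {n : nat} (p : R).
Variables (f : 'I_n -> cube n -> X) (r : {perm 'I_n}).

Lemma increment_order : increment (order_martingale f r) = order_difference f r.
Proof.
apply/funext => k; apply/funext => e; rewrite /increment /order_martingale/=.
rewrite (bigD1 k)/=; last by rewrite /bump/= add1n.
rewrite [X in _ + X - _](eq_bigl (fun j : 'I_n => (j < k)%N)) ?addrK// => j.
by rewrite /bump/= add1n ltnS ltn_neqAle andbC.
Qed.

(** UMD- applied to the martingale of the order [r], then Stein's inequality for
    its increments, which are conditional expectations of the derivatives. *)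
Lemma fixed_order_bound (b : R) (s : \bar R) :
  0 < b -> UMD_minus_with X p b -> stein_with X p s ->
  ((cube_Lp_norm p (fun e => \sum_(i < n)
      walsh_proj (initial_segment r (r i).+1)
        (partial_derivative i (f i)) e))%:E
   <= s * (b *
      (2 ^- n * \sum_(delta : cube n)
          cube_Lp_norm p (fun e : cube n =>
            (\sum_(i < n)
               cube_coord R delta i *: partial_derivative i (f i) e)%R) `^ p)
       `^ p^-1)%:E)%E.
Proof.
move=> b0 umd stein.
under eq_fun do rewrite -(order_martingale_total f r).
rewrite -Lp_norm_cube_uniform EFinM muleCA -(sign_average_order p f r).
apply: le_trans (umd _ _ _ _ _ _ _ (is_martingale_order f r) _) _.
- by apply: is_filtration_order.
- by move=> k; exact: in_Lp_cube.
rewrite lee_pmul2l// increment_order.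
apply: (stein _ _ _ _
  (fun k : 'I_n => coord_sigma_algebra (initial_segment r k.+1))).
- exact: is_filtration_order.
- by move=> k; exact: in_Lp_cube.
- by move=> k; exact: is_cond_exp_walsh_proj.
Qed.

End FixedOrderBound.

(** * Passing to the optimal constants *)

(** Finiteness of the infimum matters when [c = 0]: it makes [S] nonempty, so
    that the hypothesis yields [a <= 0]. *)
Lemma le_ereal_inf_mulr {R : realType} (S : set (\bar R)) (a c : R) :
  0 <= c -> (ereal_inf S < +oo)%E ->
  (forall s, S s -> (a%:E <= s * c%:E)%E) -> (a%:E <= ereal_inf S * c%:E)%E.
Proof.
move=> + Sfin aS; rewrite le_eqVlt => /predU1P[c0|c0].
  have [s Ss _] := ereal_inf_lt Sfin.
  by have := aS s Ss; rewrite -c0 !mule0.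
rewrite -lee_pdivrMr//; apply: le_ereal_inf_tmp => s Ss.
by rewrite lee_pdivrMr// aS.
Qed.

Theorem corollary2 (R : realType) (p : R) (hp : 1 < p)
    (X : completeNormedModType R)
    (hs : (stein_const X p < +oo)%E) (hX : UMD_minus X)
    (n : nat) (f : 'I_n -> cube n -> X) :
  ((cube_Lp_norm p (fun e : cube n =>
      (\sum_(i < n) laplacian (-1) (partial_derivative i (f i)) e)%R))%:E
   <= stein_const X p * beta_minus X p *
      ((2 ^- n * \sum_(delta : cube n)
          cube_Lp_norm p (fun e : cube n =>
            (\sum_(i < n)
               cube_coord R delta i *: partial_derivative i (f i) e)%R) `^ p)
       `^ p^-1)%R%:E)%E.
Proof.
set C := (X in (_ <= _ * X%:E)%E).
have C0 : 0 <= C by exact: powR_ge0.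
have [b [b0 umd_b]] := hX p hp.
have beta_fin : (beta_minus X p < +oo)%E.
  by apply: le_lt_trans (ltry b); apply: ereal_inf_lbound; exists b.
have beta_ge0 : (0 <= beta_minus X p)%E.
  by apply: le_ereal_inf_tmp => _ [c [c0 _] <-]; rewrite lee_fin ltW.
have stein_ge0 : (0 <= stein_const X p)%E.
  by apply: le_ereal_inf_tmp => s [s0 _]; exact: ltW.
have stein_fin_num : stein_const X p \is a fin_num by rewrite ge0_fin_numE.
have beta_fin_num : beta_minus X p \is a fin_num by rewrite ge0_fin_numE.
have order_bound r : (cube_Lp_norm p (fun e => \sum_(i < n)
      walsh_proj (initial_segment r (r i).+1) (partial_derivative i (f i)) e)
    <= fine (stein_const X p) * fine (beta_minus X p) * C).
  (* The infima are reached one at a time, the other factors being constants. *)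
  rewrite -lee_fin !EFinM !fineK// -muleA muleCA -(fineK stein_fin_num) -EFinM.
  apply: le_ereal_inf_mulr => // [|_ [c [c0 umd_c] <-]].
    by rewrite mulr_ge0// fine_ge0.
  rewrite -EFinM mulrCA EFinM fineK//.
  apply: le_ereal_inf_mulr => // [|s [_ stein_s]].
    by rewrite mulr_ge0// ltW.
  exact: fixed_order_bound.
rewrite -(fineK stein_fin_num) -(fineK beta_fin_num) -!EFinM lee_fin.
under eq_fun do rewrite laplacian_order_average -card_Sn.
apply: ler_cube_Lp_norm_avg => //.
by rewrite card_Sn fact_gt0.
Qed.
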